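(* Let $k$ be an algebraically closed field of characteristic $p>0$ and let $H_E$ and $H_{E'}$ be two Hopf algebras of third type over $k$ given by tuples $E=(G,a,c,\alpha)$ and $E'=(G',a',c',\alpha')$. Then $H_E$ and $H_{E'}$ are isomorphic as Hopf algebras if and only if there is a group isomorphism $f:G\to G'$ such that $f(a)=a'$ and $c'\circ f=c$.
   Context: Third type $H_E$. Let $E=(G,a,c,\alpha)$ where $G$ is a finite group, $a\in Z(G)$ has order divisible by $p$, $c:G\to(k,+)$ is a group homomorphism with $c(a)=1$, $\alpha\in k$, and, if $a^p\neq1$, $c(g)\in\mathbb{F}_p$ for all $g\in G$. $H_E$ is the algebra containing $kG$ and an element $x$, with basis $(gx^i)_{g\in G,\,0\le i\le p-1}$ and relations $gxg^{-1}=x+c(g)(a-1)$ ($g\in G$), $x^p=x+\alpha(a^p-1)$; its Hopf structure is $\Delta(gx^i)=(g\otimes g)(x\otimes a+1\otimes x)^i$, $\epsilon(gx^i)=\delta_{i,0}$, $S(gx^i)=(-xa^{-1})^ig^{-1}$. *)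

(* Defs.v *)
From HB Require Import structures.
From mathcomp Require Import all_boot all_fingroup all_algebra.
From mathcomp Require Import all_solvable all_field.

Set Implicit Arguments.
Unset Strict Implicit.
Unset Printing Implicit Defensive.

Import GRing.Theory.
Local Open Scope ring_scope.

(* Tensor product of finite-dimensional spaces, as matrices of coordinates in  *)
(* the reference bases [tbasis]; [tlift_pure] and [tensor_ext] below give the  *)
(* universal property, so that nothing depends on the choice of these bases.   *)
Definition tensor (k : fieldType) (U V : vectType k) : Type :=
  'M[k]_(\dim {:U}, \dim {:V}).

HB.instance Definition _ (k : fieldType) (U V : vectType k) :=
  Vector.copy (tensor U V) 'M[k]_(\dim {:U}, \dim {:V}).

Notation "U ⊗ V" := (tensor U V) (at level 40, left associativity) : type_scope.

Definition is_bilinear (k : fieldType) (U V W : vectType k)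
    (b : U -> V -> W) : Prop :=
  (forall v, linear (b^~ v)) /\ (forall u, linear (b u)).

Section Tensor.
Variable k : fieldType.
Implicit Types U V W : vectType k.

Definition tbasis V (i : 'I_(\dim {:V})) : V := (vbasis {:V})`_i.

Definition tcoord V (v : V) (i : 'I_(\dim {:V})) : k := coord (vbasis {:V}) i v.

Definition pure U V (u : U) (v : V) : U ⊗ V :=
  \matrix_(i, j) (tcoord u i * tcoord v j).

(* The linear map on the tensor product induced by a bilinear map. *)
Definition tlift U V W (b : U -> V -> W) (t : U ⊗ V) : W :=
  \sum_i \sum_j (t : 'M_(_, _)) i j *: b (tbasis i) (tbasis j).

Definition tmap U V U' V' (f : U -> U') (g : V -> V') : U ⊗ V -> U' ⊗ V' :=
  tlift (fun u v => pure (f u) (g v)).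

Definition tassoc U V W : (U ⊗ V) ⊗ W -> U ⊗ (V ⊗ W) :=
  tlift (fun t w => tlift (fun u v => pure u (pure v w)) t).

Lemma tlift_is_linear U V W (b : U -> V -> W) : linear (tlift b).
Proof.
move=> a s t; rewrite /tlift scaler_sumr -big_split; apply: eq_bigr => i _ /=.
rewrite scaler_sumr -big_split; apply: eq_bigr => j _ /=.
by rewrite !mxE scalerDl scalerA.
Qed.

HB.instance Definition _ U V W (b : U -> V -> W) :=
  GRing.isLinear.Build k (U ⊗ V) W *:%R (tlift b) (tlift_is_linear b).

Lemma pure_bilinear U V : is_bilinear (@pure U V).
Proof.
split=> [v a u u' | u a v v']; apply/matrixP => i j; rewrite !mxE /tcoord linearP /=.
  by rewrite mulrDl mulrA.
by rewrite mulrDr mulrCA.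
Qed.

Lemma tbasis_sum V (v : V) : v = \sum_i tcoord v i *: tbasis i.
Proof. by rewrite {1}(coord_vbasis (memvf v)). Qed.

Lemma tcoord_basis V (i j : 'I_(\dim {:V})) : tcoord (tbasis i) j = (i == j)%:R.
Proof.
by rewrite /tcoord /tbasis (coord_free _ _ (basis_free (vbasisP _))) eq_sym.
Qed.

Lemma is_bilinear_suml U V W (b : U -> V -> W) (I : finType) (c : I -> k)
    (f : I -> U) v :
  is_bilinear b -> b (\sum_i c i *: f i) v = \sum_i c i *: b (f i) v.
Proof.
case=> hb _; have b0 : b 0 v = 0.
  by have := hb v (-1) 0 0; rewrite scaleN1r oppr0 addr0 scaleN1r addNr.
by elim/big_rec2: _ => [|i y1 y2 _ <-]; [exact: b0 | exact: hb].
Qed.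

Lemma is_bilinear_sumr U V W (b : U -> V -> W) (I : finType) (c : I -> k)
    (f : I -> V) u :
  is_bilinear b -> b u (\sum_i c i *: f i) = \sum_i c i *: b u (f i).
Proof.
case=> _ hb; have b0 : b u 0 = 0.
  by have := hb u (-1) 0 0; rewrite scaleN1r oppr0 addr0 scaleN1r addNr.
by elim/big_rec2: _ => [|i y1 y2 _ <-]; [exact: b0 | exact: hb].
Qed.

Lemma tlift_pure U V W (b : U -> V -> W) u v :
  is_bilinear b -> tlift b (pure u v) = b u v.
Proof.
move=> hb; rewrite [in RHS](tbasis_sum u) is_bilinear_suml //.
apply: eq_bigr => i _; rewrite [in RHS](tbasis_sum v) is_bilinear_sumr //.
rewrite scaler_sumr; apply: eq_bigr => j _.
by rewrite mxE scalerA.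
Qed.

Lemma tensor_pure U V (t : U ⊗ V) :
  t = \sum_i \sum_j (t : 'M_(_, _)) i j *: pure (tbasis i) (tbasis j).
Proof.
rewrite {1}[t]matrix_sum_delta; apply: eq_bigr => i _; apply: eq_bigr => j _.
congr (_ *: _); apply/matrixP => i' j'.
by rewrite !mxE !tcoord_basis -natrM mulnb [i == _]eq_sym [j == _]eq_sym.
Qed.

Lemma tensor_ext U V W (f g : U ⊗ V -> W) :
  linear f -> linear g -> (forall u v, f (pure u v) = g (pure u v)) -> f =1 g.
Proof.
move=> lf lg fg t; rewrite (tensor_pure t).
pose F : {linear U ⊗ V -> W} :=
  HB.pack f (GRing.isLinear.Build k _ _ *:%R f lf).
pose G : {linear U ⊗ V -> W} :=
  HB.pack g (GRing.isLinear.Build k _ _ *:%R g lg).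
rewrite -[f]/(F : _ -> _) -[g]/(G : _ -> _) !linear_sum.
apply: eq_bigr => i _; rewrite !linear_sum; apply: eq_bigr => j _.
by rewrite !linearZ /= fg.
Qed.

End Tensor.

Section TensorAlgebra.
Variables (k : fieldType) (A B : falgType k).

Definition tmul (s t : A ⊗ B) : A ⊗ B :=
  tlift (fun a b => tlift (fun a' b' => pure (a * a') (b * b')) t) s.

Definition tone : A ⊗ B := pure 1 1.

Lemma tmul_inner_bilinear a b :
  is_bilinear (fun (a' : A) (b' : B) => pure (a * a') (b * b')).
Proof.
have [pl pr] := @pure_bilinear k A B.
split=> [v c u u' | u c v v']; rewrite mulrDr -scalerAr; [exact: pl|exact: pr].
Qed.

Lemma tmul_linearl t : linear (tmul^~ t).
Proof. by move=> c s s'; rewrite /tmul linearP. Qed.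

Lemma tmul_linearr s : linear (tmul s).
Proof.
move=> c t t'; rewrite /tmul.
have E r : tlift (fun a b => tlift (fun a' b' => pure (a * a') (b * b')) r) s =
    \sum_i \sum_j (s : 'M_(_, _)) i j *:
      tlift (fun a' b' => pure (tbasis i * a') (tbasis j * b')) r by [].
rewrite !E scaler_sumr -big_split; apply: eq_bigr => i _ /=.
rewrite scaler_sumr -big_split; apply: eq_bigr => j _ /=.
by rewrite linearP scalerDr !scalerA mulrC.
Qed.

Lemma tmul_outer_bilinear t :
  is_bilinear (fun (a : A) (b : B) =>
    tlift (fun a' b' => pure (a * a') (b * b')) t).
Proof.
have [pl pr] := @pure_bilinear k A B.
split=> [b c a1 a2 | a c b1 b2]; rewrite /tlift scaler_sumr -big_split.
  apply: eq_bigr => i _ /=; rewrite scaler_sumr -big_split; apply: eq_bigr => j _ /=.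
  by rewrite mulrDl -scalerAl pl scalerDr !scalerA mulrC.
apply: eq_bigr => i _ /=; rewrite scaler_sumr -big_split; apply: eq_bigr => j _ /=.
by rewrite mulrDl -scalerAl pr scalerDr !scalerA mulrC.
Qed.

Lemma tmul_pure a b a' b' :
  tmul (pure a b) (pure a' b') = pure (a * a') (b * b').
Proof.
rewrite /tmul tlift_pure; last exact: tmul_outer_bilinear.
by rewrite tlift_pure //; exact: tmul_inner_bilinear.
Qed.

Lemma tmul1 : left_id tone tmul.
Proof.
apply: tensor_ext => [||u v]; [exact: tmul_linearr | by [] |].
by rewrite tmul_pure !mul1r.
Qed.

Lemma tmulr1 : right_id tone tmul.
Proof.
apply: (tensor_ext (f := tmul^~ tone)) => [||u v]; [exact: tmul_linearl | by [] |].
by rewrite tmul_pure !mulr1.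
Qed.

Lemma tmulDl : left_distributive tmul +%R.
Proof. by move=> s s' t; have := tmul_linearl t 1 s s'; rewrite !scale1r. Qed.

Lemma tmulDr : right_distributive tmul +%R.
Proof. by move=> s t t'; have := tmul_linearr s 1 t t'; rewrite !scale1r. Qed.

Lemma tmulA : associative tmul.
Proof.
move=> r s t.
apply: (tensor_ext (f := fun r => tmul r (tmul s t))
                   (g := fun r => tmul (tmul r s) t)) => [||a b].
- exact: tmul_linearl.
- by move=> c x y; rewrite !tmul_linearl.
apply: (tensor_ext (f := fun s => tmul (pure a b) (tmul s t))
                   (g := fun s => tmul (tmul (pure a b) s) t)) => [||a' b'].
- by move=> c x y; rewrite tmul_linearl tmul_linearr.
- by move=> c x y; rewrite tmul_linearr tmul_linearl.
apply: (tensor_ext (f := fun t => tmul (pure a b) (tmul (pure a' b') t))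
                   (g := tmul (tmul (pure a b) (pure a' b')))) => [||a'' b''].
- by move=> c x y; rewrite !tmul_linearr.
- exact: tmul_linearr.
by rewrite !tmul_pure !mulrA.
Qed.

Lemma tone_neq0 : tone != 0.
Proof.
have nz (C : falgType k) : exists i, tcoord (1 : C) i != 0.
  apply/existsP; rewrite -negb_forall; apply/negP => /forallP h.
  have /eqP[] := oner_neq0 C; rewrite (tbasis_sum (1 : C)) big1 // => i _.
  by rewrite (eqP (h i)) scale0r.
have [[i hi] [j hj]] := (nz A, nz B).
apply/eqP => /matrixP/(_ i j); rewrite !mxE => /eqP.
by rewrite mulf_eq0 (negPf hi) (negPf hj).
Qed.

HB.instance Definition _ := GRing.Zmodule_isNzRing.Build (A ⊗ B)
  tmulA tmul1 tmulr1 tmulDl tmulDr tone_neq0.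

Lemma tscaleAl (c : k) (s t : A ⊗ B) : c *: (s * t) = (c *: s) * t.
Proof.
by have /= := tmul_linearl t c s 0; rewrite addr0 -[X in _ + X]/(0 * t) mul0r addr0.
Qed.

Lemma tscaleAr (c : k) (s t : A ⊗ B) : c *: (s * t) = s * (c *: t).
Proof.
by have /= := tmul_linearr s c t 0; rewrite addr0 -[X in _ + X]/(s * 0) mulr0 addr0.
Qed.

HB.instance Definition _ := GRing.Lmodule_isLalgebra.Build k (A ⊗ B) tscaleAl.
HB.instance Definition _ := GRing.Lalgebra_isAlgebra.Build k (A ⊗ B) tscaleAr.
HB.instance Definition _ := Algebra_isFalgebra.Build k (A ⊗ B).

Lemma mul_pure (a a' : A) (b b' : B) :
  pure a b * pure a' b' = pure (a * a') (b * b').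
Proof. exact: tmul_pure. Qed.

End TensorAlgebra.

Record hopfAlg (k : fieldType) := HopfAlg {
  hopf_alg :> falgType k;
  comul : {lrmorphism hopf_alg -> hopf_alg ⊗ hopf_alg};
  counit : {lrmorphism hopf_alg -> k^o};
  antipode : {linear hopf_alg -> hopf_alg};
  comulA : forall h,
    tassoc (tmap comul id (comul h)) = tmap id comul (comul h);
  counitl : forall h, tlift (fun u v => counit u *: v) (comul h) = h;
  counitr : forall h, tlift (fun u v => counit v *: u) (comul h) = h;
  antipodel : forall h, tlift (fun u v => antipode u * v) (comul h) = (counit h)%:A;
  antipoder : forall h, tlift (fun u v => u * antipode v) (comul h) = (counit h)%:A
}.

Definition hopf_morphism (k : fieldType) (H H' : hopfAlg k)
    (phi : {lrmorphism H -> H'}) : Prop :=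
  [/\ forall h, comul H' (phi h) = tmap phi phi (comul H h),
      forall h, counit H' (phi h) = counit H h
    & forall h, antipode H' (phi h) = phi (antipode H h)].

Definition hopf_isomorphic (k : fieldType) (H H' : hopfAlg k) : Prop :=
  exists phi : {lrmorphism H -> H'}, hopf_morphism phi /\ bijective phi.

(* The tuples (G, a, c, alpha); the group G is the whole of [E3_G].  The prime *)
(* subfield F_p of k is the set of the n%:R.                                   *)
Record thirdTypeData (k : fieldType) (p : nat) := ThirdTypeData {
  E3_G :> finGroupType;
  E3_a : E3_G;
  E3_c : E3_G -> k;
  E3_alpha : k;
  E3_a_central : E3_a \in 'Z([set: E3_G])%g;
  E3_a_order : (p %| #[E3_a]%g)%N;
  E3_c_morph : forall g h : E3_G, E3_c (g * h)%g = E3_c g + E3_c h;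
  E3_c_a : E3_c E3_a = 1;
  E3_c_Fp : (E3_a ^+ p)%g != 1%g -> forall g, exists n : nat, E3_c g = n%:R
}.

(* [presents iota x]: H is H_E, where iota : G -> H is the inclusion of the  *)
(* elements of G.  Its linear extension embeds kG in H because of the basis.   *)
Record presents (k : fieldType) (p : nat) (E : thirdTypeData k p)
    (H : hopfAlg k) (iota : E -> H) (x : H) : Prop := Presents {
  iota1 : iota 1%g = 1;
  iotaM : forall g h : E, iota (g * h)%g = iota g * iota h;
  gx_basis : basis_of {:H}
    [seq iota gi.1 * x ^+ gi.2 | gi : E * 'I_p];
  x_conj : forall g : E,
    iota g * x * iota g^-1%g = x + E3_c g *: (iota (E3_a E) - 1);
  x_pow : x ^+ p = x + E3_alpha E *: (iota (E3_a E ^+ p)%g - 1);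
  comul_gx : forall (g : E) (i : 'I_p),
    comul H (iota g * x ^+ i) =
      pure (iota g) (iota g) * (pure x (iota (E3_a E)) + pure 1 x) ^+ i;
  counit_gx : forall (g : E) (i : 'I_p),
    counit H (iota g * x ^+ i) = (i == 0 :> nat)%:R;
  antipode_gx : forall (g : E) (i : 'I_p),
    antipode H (iota g * x ^+ i) =
      (- x * iota (E3_a E)^-1%g) ^+ i * iota g^-1%g
}.

Definition is_third_type (k : fieldType) (p : nat) (E : thirdTypeData k p)
    (H : hopfAlg k) : Prop :=
  exists (iota : E -> H) (x : H), presents iota x.

(* Main.v *)
Require Import Defs.
From HB Require Import structures.
From mathcomp Require Import all_boot all_fingroup all_algebra.
From mathcomp Require Import all_solvable all_field.

Set Implicit Arguments.
Unset Strict Implicit.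
Unset Printing Implicit Defensive.

Import GRing.Theory.
Local Open Scope ring_scope.

(** Write a, x for the generators of H = H_E and a', x' for those of H' = H_E'.

    Sufficiency.  Given f, the algebra H maps to H' by g |-> f(g) and
    x |-> y := x' + l (a' - 1), provided that y satisfies the relations of x
    ([presents_lift]).  The conjugation relation holds for every l because a'
    is central in G'.  For the relation on y^p one uses
      (x' + l (a' - 1))^p = x'^p + l (a' - 1) + (l^p - l) (a'^p - 1)
    ([shift_pow]), so that it suffices to choose l with
    l^p - l = alpha - alpha', which is possible over an algebraically closed
    field; this is why alpha is not an invariant.  The formula is obtained
    without computing p-th powers in a noncommutative ring: both sides are
    polynomials of degree at most p in l with the same coefficient at l^p, and
    they agree at the p elements l = n of the prime field because
    x' + n (a' - 1) is the conjugate of x' by a'^n ([expr_affine]).  The map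
    respects the coproduct and the counit, which can be tested on generators,
    hence also the antipode ([bialgebra_morphism_antipode]), and it is a
    surjection between spaces of equal dimension.

    Necessity.  A Hopf isomorphism phi maps group-like elements to group-like
    elements, and those of H' are the elements of G' ([group_like]); this gives
    f.  Then phi(x) is skew-primitive for the pair f(a), 1.  Such elements have
    the form mu x' + l0 + l1 f(a), with f(a) = a' unless mu = 0
    ([skew_primitive]).  Now phi transports g x g^-1 = x + c(g) (a - 1) to
    phi(x).  If mu were 0, then phi(x) would commute with f(a), against the
    relation for g = a.  So f(a) = a', and comparing coefficients gives
    mu c'(f(g)) = c(g) for all g; for g = a this is mu = 1.

    Both classifications of elements of H' come from looking at the coproduct
    only through its left tensor factor: applying the coordinate functional of
    g x^i to the left factor of Delta(h) gives an explicit sum over the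
    coordinates of h ([left_coef_comul]), whose leading terms are simple. *)

(** * Bases and linear maps *)

Section LinearAlgebra.
Variable k : fieldType.

(** Coordinates indexed by the finite type that enumerates the basis, instead of
    by the ordinals of [coord]. *)
Lemma dual_basis (V : vectType k) (I : finType) (b : I -> V) :
  basis_of {:V} [seq b i | i : I] ->
  exists xi : I -> {linear V -> k^o},
    (forall i j, xi i (b j) = (i == j)%:R) /\
    (forall v, v = \sum_i xi i v *: b i).
Proof.
move=> basb; pose X := codom_tuple b.
have Xb i : X`_(enum_rank i) = b i.
  by rewrite /= codomE (nth_map i) ?nth_enum_rank // -cardE ltn_ord.
exists (fun i => coord X (enum_rank i)); split=> [i j|v].
  rewrite -(Xb j) /= -[codom b]/(tval X) coord_free ?(basis_free basb) //.
  by rewrite (inj_eq enum_rank_inj) eq_sym.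
rewrite {1}(coord_basis (X := X) basb (memvf v)).
rewrite (reindex (@enum_rank I)) /=; last exact: onW_bij (enum_rank_bij _).
by apply: eq_bigr => i _; rewrite -[in RHS]Xb.
Qed.

Lemma linear_from_basis (V W : vectType k) (I : finType) (b : I -> V)
    (w : I -> W) : basis_of {:V} [seq b i | i : I] ->
  exists phi : {linear V -> W}, forall i, phi (b i) = w i.
Proof.
case/dual_basis=> xi [xib _].
pose f v := \sum_i xi i v *: w i.
have lf : linear f.
  move=> c u v; rewrite /f scaler_sumr -big_split; apply: eq_bigr => i _ /=.
  by rewrite linearP scalerDl scalerA.
pose F : {linear V -> W} := HB.pack f (GRing.isLinear.Build k _ _ *:%R f lf).
exists F => i; rewrite /F /= /f (bigD1 i) //= xib eqxx scale1r big1 ?addr0 //.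
by move=> j /negPf nij; rewrite xib nij scale0r.
Qed.

Lemma linear_ext_basis (V : vectType k) (W : lmodType k) (I : finType)
    (b : I -> V) (f g : V -> W) : basis_of {:V} [seq b i | i : I] ->
  linear f -> linear g -> (forall i, f (b i) = g (b i)) -> f =1 g.
Proof.
case/dual_basis=> xi [_ vE] lf lg fg v.
pose F : {linear V -> W} := HB.pack f (GRing.isLinear.Build k _ _ *:%R f lf).
pose G : {linear V -> W} := HB.pack g (GRing.isLinear.Build k _ _ *:%R g lg).
rewrite -[f]/(F : _ -> _) -[g]/(G : _ -> _) (vE v) !linear_sum.
by apply: eq_bigr => i _; rewrite !linearZ /= fg.
Qed.

Lemma surj_linear_bij (V W : vectType k) (phi : {linear V -> W}) :
  \dim {:V} = \dim {:W} -> (forall w, exists v, phi v = w) -> bijective phi.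
Proof.
move=> dimVW surj.
have imf : limg (linfun phi) = fullv.
  apply/vspaceP => w; rewrite memvf; have [v <-] := surj w.
  by rewrite -(lfunE phi) memv_img ?memvf.
have inj : injective phi.
  suff /lker0P inj : lker (linfun phi) == 0%VS.
    by move=> u v eq_uv; apply: inj; rewrite !lfunE.
  rewrite -dimv_eq0 -(capfv (lker _)) -(eqn_add2r (\dim (limg (linfun phi)))).
  by rewrite limg_ker_dim imf dimVW.
have surjP w : exists v, phi v == w by have [v <-] := surj w; exists v.
exists (fun w => xchoose (surjP w)) => [v|w]; last first.
  exact/eqP/(xchooseP (surjP w)).
by apply: inj; apply/eqP/(xchooseP (surjP (phi v))).
Qed.

Lemma bij_linear_dim (V W : vectType k) (phi : {linear V -> W}) :
  bijective phi -> \dim {:V} = \dim {:W}.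
Proof.
case=> psi phiK psiK.
have inj : (fullv :&: lker (linfun phi) = 0)%VS.
  apply/eqP; rewrite capfv; apply/lker0P => u v.
  by rewrite !lfunE => /(can_inj phiK).
rewrite -(limg_dim_eq inj); congr (\dim _); apply/vspaceP => w.
by rewrite memvf -(psiK w) -(lfunE phi) memv_img ?memvf.
Qed.

End LinearAlgebra.

(** * Maps between tensor products *)

Section TensorMaps.
Variable k : fieldType.

Lemma pureD1l (U V : vectType k) c (u u' : U) (v : V) :
  pure (c *: u + u') v = c *: pure u v + pure u' v.
Proof. exact: (pure_bilinear U V).1. Qed.

Lemma pureD1r (U V : vectType k) c (u : U) (v v' : V) :
  pure u (c *: v + v') = c *: pure u v + pure u v'.
Proof. exact: (pure_bilinear U V).2. Qed.

Lemma pureDl (U V : vectType k) (u u' : U) (v : V) :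
  pure (u + u') v = pure u v + pure u' v.
Proof. by have := pureD1l 1 u u' v; rewrite !scale1r. Qed.

Lemma pureDr (U V : vectType k) (u : U) (v v' : V) :
  pure u (v + v') = pure u v + pure u v'.
Proof. by have := pureD1r 1 u v v'; rewrite !scale1r. Qed.

Lemma pure0l (U V : vectType k) (v : V) : pure (0 : U) v = 0.
Proof. by apply/matrixP => i j; rewrite !mxE /tcoord linear0 mul0r. Qed.

Lemma pure0r (U V : vectType k) (u : U) : pure u (0 : V) = 0.
Proof. by apply/matrixP => i j; rewrite !mxE /tcoord linear0 mulr0. Qed.

Lemma pureZl (U V : vectType k) c (u : U) (v : V) :
  pure (c *: u) v = c *: pure u v.
Proof. by have := pureD1l c u 0 v; rewrite pure0l !addr0. Qed.

Lemma pureZr (U V : vectType k) c (u : U) (v : V) :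
  pure u (c *: v) = c *: pure u v.
Proof. by have := pureD1r c u v 0; rewrite pure0r !addr0. Qed.

Lemma pureNl (U V : vectType k) (u : U) (v : V) : pure (- u) v = - pure u v.
Proof. by rewrite -!scaleN1r pureZl. Qed.

Lemma pureNr (U V : vectType k) (u : U) (v : V) : pure u (- v) = - pure u v.
Proof. by rewrite -!scaleN1r pureZr. Qed.

Lemma tmap_pure (U V U' V' : vectType k) (f : {linear U -> U'})
    (g : {linear V -> V'}) u v : tmap f g (pure u v) = pure (f u) (g v).
Proof.
apply: tlift_pure; split=> [w c x y|w c x y]; rewrite linearP.
  exact: pureD1l.
exact: pureD1r.
Qed.

HB.instance Definition _ (U V U' V' : vectType k) (f : U -> U') (g : V -> V') :=
  GRing.Linear.copy (tmap f g) (tlift (fun u v => pure (f u) (g v))).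

Lemma mul_bilinear (H A : falgType k) (f g : {linear H -> A}) :
  is_bilinear (fun u v => f u * g v).
Proof.
split=> [w c x y|w c x y]; rewrite linearP.
  by rewrite mulrDl scalerAl.
by rewrite mulrDr scalerAr.
Qed.

Lemma tmap_monoid_morphism (A B A' B' : falgType k) (f : {lrmorphism A -> A'})
    (g : {lrmorphism B -> B'}) : GRing.monoid_morphism (tmap f g).
Proof.
split; first by rewrite [1]/(pure 1 1) tmap_pure !rmorph1.
move=> s t; move: s.
apply: (tensor_ext (f := fun s => tmap f g (s * t))
                   (g := fun s => tmap f g s * tmap f g t)) => [||a b].
- by move=> c u v; rewrite mulrDl -scalerAl linearP.
- by move=> c u v; rewrite linearP mulrDl -scalerAl.
move: t; apply: (tensor_ext (f := fun t => tmap f g (pure a b * t))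
  (g := fun t => tmap f g (pure a b) * tmap f g t)) => [||a' b'].
- by move=> c u v; rewrite mulrDr -scalerAr linearP.
- by move=> c u v; rewrite linearP mulrDr -scalerAr.
by rewrite mul_pure !tmap_pure mul_pure !rmorphM.
Qed.

HB.instance Definition _ (A B A' B' : falgType k) (f : {lrmorphism A -> A'})
    (g : {lrmorphism B -> B'}) :=
  GRing.isMonoidMorphism.Build (A ⊗ B) (A' ⊗ B') (tmap f g)
    (tmap_monoid_morphism f g).

End TensorMaps.

(** * Convolution and antipodes *)

Section Antipode.
Variables (k : fieldType) (H : hopfAlg k) (A : falgType k).
Implicit Types f g e : {linear H -> A}.

Definition conv (f g : H -> A) (h : H) : A :=
  tlift (fun u v => f u * g v) (comul H h).

Lemma conv_linear (f g : H -> A) : linear (conv f g).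
Proof. by move=> c u v; rewrite /conv !linearP. Qed.

HB.instance Definition _ (f g : H -> A) :=
  GRing.isLinear.Build k H A *:%R (conv f g) (conv_linear f g).

(** Both sides are the image of the two-fold coproduct of [h] under [T], the map
    u ⊗ (v ⊗ w) |-> f(u) g(v) e(w). *)
Lemma convA f g e : conv f (conv g e) =1 conv (conv f g) e.
Proof.
move=> h.
pose T := tlift (fun u t => f u * tlift (fun v w => g v * e w) t) :
  H ⊗ (H ⊗ H) -> A.
have T_pure u t : T (pure u t) = f u * tlift (fun v w => g v * e w) t.
  apply: tlift_pure; split=> [w c x y|w c x y]; rewrite linearP.
    by rewrite mulrDl scalerAl.
  by rewrite mulrDr scalerAr.
have -> : conv f (conv g e) h = T (tmap id (comul H) (comul H h)).
  rewrite /conv; move: (comul H h); apply: tensor_ext => [||u v].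
  - by move=> c s t; rewrite linearP.
  - by move=> c s t; rewrite /T !linearP.
  rewrite (tmap_pure idfun) T_pure tlift_pure //.
  exact: (mul_bilinear f (conv g e)).
have -> : conv (conv f g) e h = T (tassoc (tmap (comul H) id (comul H h))).
  rewrite {1}/conv; move: (comul H h); apply: tensor_ext => [||u v].
  - by move=> c s t; rewrite linearP.
  - by move=> c s t; rewrite /T /tassoc !linearP.
  rewrite (tmap_pure _ idfun) tlift_pure; last exact: (mul_bilinear (conv f g)).
  rewrite /tassoc tlift_pure; last first.
    split=> [w c s t|t c w w']; first by rewrite linearP.
    move: t; apply: tensor_ext => [||x y].
    - by move=> d s t; rewrite linearP.
    - move=> d s t.
      by rewrite !linearD !linearZ /= !scalerA [d * c]mulrC addrACA.
    by rewrite !tlift_pure; [rewrite !pureD1r | | |]; split=> [z d s t|z d s t];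
      rewrite ?pureD1l ?pureD1r.
  pose L (t : H ⊗ H) := tlift (fun u v => f u * g v) t * e v.
  pose R (t : H ⊗ H) : A := T (tlift (fun u w => pure u (pure w v)) t).
  suff LR : L =1 R by exact: (LR (comul H u)).
  rewrite /L /R; apply: tensor_ext => [||x y].
  - by move=> c s t; rewrite linearP mulrDl scalerAl.
  - by move=> c s t; rewrite /T !linearP.
  rewrite tlift_pure; last exact: mul_bilinear.
  rewrite tlift_pure; last first.
    by split=> [z d s t|z d s t]; rewrite ?pureD1l ?pureD1r.
  rewrite T_pure tlift_pure ?mulrA //; exact: mul_bilinear.
by rewrite comulA.
Qed.

Lemma conv_unitl g : conv (fun h => counit H h *: 1) g =1 g.
Proof.
move=> h; rewrite -[in RHS](counitl h) /conv; move: (comul H h).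
apply: tensor_ext => [||u v].
- by move=> c s t; rewrite linearP.
- by move=> c s t; rewrite !linearP.
rewrite !tlift_pure ?linearZ ?mulr_algl //; split=> [z d s t|z d s t].
- by rewrite linearP scalerDl scalerA.
- by rewrite linearP.
- by rewrite linearP scalerDl mulrDl -scalerA !scalerAl.
- by rewrite linearP mulrDr scalerAr.
Qed.

Lemma conv_unitr f : conv f (fun h => counit H h *: 1) =1 f.
Proof.
move=> h; rewrite -[in RHS](counitr h) /conv; move: (comul H h).
apply: tensor_ext => [||u v].
- by move=> c s t; rewrite linearP.
- by move=> c s t; rewrite !linearP.
rewrite !tlift_pure ?linearZ ?mulr_algr //; split=> [z d s t|z d s t].
- by rewrite linearP.
- by rewrite linearP scalerDl scalerA.
- by rewrite linearP mulrDl scalerAl.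
- by rewrite linearP scalerDl mulrDr -scalerA !scalerAr.
Qed.

Lemma conv_inverse_unique f g e :
  conv f g =1 (fun h => counit H h *: 1) ->
  conv g e =1 (fun h => counit H h *: 1) -> f =1 e.
Proof.
move=> fg ge h.
have conv_ext (u u' v v' : H -> A) :
    u =1 u' -> v =1 v' -> conv u v h = conv u' v' h.
  move=> uu' vv'; apply: eq_bigr => i _; apply: eq_bigr => j _.
  by rewrite uu' vv'.
have := convA f g e h.
rewrite (conv_ext f f _ (fun h => counit H h *: 1)) //.
rewrite (conv_ext _ (fun h => counit H h *: 1) e e fg (frefl _)).
by rewrite conv_unitr conv_unitl.
Qed.

End Antipode.

(** The two sides are the left and the right convolution inverse of [phi]. *)
Lemma bialgebra_morphism_antipode (k : fieldType) (H H' : hopfAlg k)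
    (phi : {lrmorphism H -> H'}) :
  (forall h, comul H' (phi h) = tmap phi phi (comul H h)) ->
  (forall h, counit H' (phi h) = counit H h) ->
  forall h, antipode H' (phi h) = phi (antipode H h).
Proof.
move=> phiD phie.
apply: (@conv_inverse_unique _ _ _ (antipode H' \o phi) phi (phi \o antipode H))
  => h.
  rewrite -phie -antipodel phiD /conv; move: (comul H h).
  apply: tensor_ext => [||u v]; first by move=> c s t; rewrite linearP.
    by move=> c s t; rewrite !linearP.
  rewrite tmap_pure !tlift_pure //; first exact: (mul_bilinear _ idfun).
  exact: (mul_bilinear (antipode H' \o phi) phi).
transitivity (phi ((counit H h)%:A)); last by rewrite linearZ /= rmorph1.
rewrite -antipoder /conv; move: (comul H h).
apply: tensor_ext => [||u v]; first by move=> c s t; rewrite linearP.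
  by move=> c s t; rewrite !linearP.
rewrite !tlift_pure ?rmorphM //; first exact: (mul_bilinear idfun).
exact: (mul_bilinear phi (phi \o antipode H)).
Qed.

(** * The p-th power of x + l u *)

Section Power.
Variables (k : fieldType) (A : falgType k) (p : nat).
Hypothesis hp : p \in [pchar k].

Lemma size_expr_affine (x u : A) n :
  (size ((x%:P + u%:P * 'X) ^+ n - (u ^+ n)%:P * 'X^n)%R <= n)%N.
Proof.
elim: n => [|n IHn]; first by rewrite !expr0 mulr1 subrr size_poly0.
set B : {poly A} := x%:P + _ in IHn *.
have -> : B ^+ n.+1 - (u ^+ n.+1)%:P * 'X^(n.+1) =
    B * (B ^+ n - (u ^+ n)%:P * 'X^n) + (x * u ^+ n)%:P * 'X^n.
  rewrite mulrBr -exprS -addrA; congr (_ + _).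
  rewrite /B mulrDl !polyCM opprD [X in _ = X]addrC mulrA addrA subrr sub0r.
  congr (- _); rewrite exprS polyCM [in RHS]mulrA -[u%:P * 'X * _]mulrA.
  by rewrite -['X * _]commr_polyX exprS -!mulrA.
have sB : (size B <= 2)%N.
  apply: leq_trans (size_polyD _ _) _; rewrite geq_max; apply/andP; split.
    exact: leq_trans (size_polyC_leq1 _) _.
  apply: leq_trans (size_polyMleq _ _) _; rewrite size_polyX addn2 /=.
  by rewrite ltnS size_polyC_leq1.
apply: leq_trans (size_polyD _ _) _; rewrite geq_max; apply/andP; split.
  apply: leq_trans (size_polyMleq _ _) _.
  by rewrite -subn1 leq_subLR add1n -[n.+2]add2n leq_add.
apply: leq_trans (size_polyMleq _ _) _; rewrite size_polyXn addnS /=.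
by rewrite -[n.+1]add1n leq_add2r size_polyC_leq1.
Qed.

Lemma uniq_roots_scalars (s : seq k) :
  uniq s -> uniq_roots [seq c%:A : A | c <- s].
Proof.
elim: s => //= c s IHs /andP[c_s /IHs->]; rewrite andbT.
apply/allP => _ /mapP[d d_s ->]; rewrite /diff_roots.
rewrite -!scalerAl !mul1r !scalerA mulrC eqxx /= -scalerBl.
rewrite (rmorph_unit (in_alg A)) // unitfE subr_eq0.
by apply: contraNneq c_s => <-.
Qed.

(** Seen as a polynomial in [l] with coefficients in [A], the difference of
    the two sides has degree less than [p]: the terms with [l ^+ p] cancel.
    By hypothesis it vanishes on the [p] elements of the prime field, whose
    differences are units of [A], so it is zero. *)
Lemma expr_affine (x u : A) :
  (forall n : nat, (x + n%:R *: u) ^+ p = x ^+ p + n%:R *: u) ->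
  forall l : k,
    (x + l *: u) ^+ p = x ^+ p + l *: u + (l ^+ p - l) *: u ^+ p.
Proof.
move=> xu l.
have p_gt1 : (1 < p)%N := prime_gt1 (pcharf_prime hp).
pose B : {poly A} := x%:P + u%:P * 'X.
pose Q := B ^+ p - (u ^+ p)%:P * 'X^p - (x ^+ p)%:P - (u - u ^+ p)%:P * 'X.
have comZ (c : k) (v : A) : GRing.comm v c%:A.
  by rewrite /GRing.comm mulr_algl mulr_algr.
have BE c : B.[c%:A] = x + c *: u.
  by rewrite /B hornerD hornerMX !hornerC mulr_algr.
have QE c : Q.[c%:A] = (x + c *: u) ^+ p - (x ^+ p + c *: u)
    - (c ^+ p - c) *: u ^+ p.
  rewrite /Q !hornerD !hornerN hornerMX !hornerC horner_exp_comm; last first.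
    by rewrite /comm_poly BE; apply/commr_sym/comZ.
  rewrite BE hornerCM hornerXn exprZn expr1n !mulr_algr.
  rewrite scalerBl scalerBr !opprB !opprD !addrA.
  by rewrite [LHS](ACl (1*3*5*4*2)).
suff Q0 : Q = 0.
  have := QE l; rewrite Q0 horner0 => /esym/eqP.
  by rewrite -addrA -opprD subr_eq0 => /eqP.
apply/eqP; apply: contraT => Q_neq0.
pose s := [seq i%:R | i <- iota 0 p] : seq k.
have s_uniq : uniq s.
  rewrite map_inj_in_uniq ?iota_uniq // => i j.
  wlog le_ij : i j / (i <= j)%N => [wl|].
    by case/orP: (leq_total i j) => le_ij hi hj e; [|apply: esym]; apply: wl.
  rewrite !mem_iota /= !add0n => _ lt_jp /esym/eqP.
  rewrite -subr_eq0 -natrB // -(dvdn_pcharf hp) => p_dv.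
  apply/eqP; rewrite eqn_leq le_ij -subn_eq0 /=.
  by rewrite -leqn0 leqNgt; apply: contraL p_dv => gt0; rewrite gtnNdvd //
     (leq_ltn_trans (leq_subr _ _)).
have /(max_ring_poly_roots Q_neq0) : all (root Q) [seq c%:A | c <- s].
  apply/allP => _ /mapP[_ /mapP[i _ ->] ->].
  by rewrite rootE QE xu subrr sub0r -pFrobenius_autE pFrobenius_aut_nat
    subrr scale0r oppr0.
rewrite !size_map size_iota => /(_ (uniq_roots_scalars s_uniq)) lt_pQ.
have : (size Q <= p)%N.
  have leD (q r : {poly A}) :
      (size q <= p)%N -> (size r <= p)%N -> (size (q + r)%R <= p)%N.
    by move=> hq hr; apply: leq_trans (size_polyD _ _) _; rewrite geq_max hq.
  rewrite /Q; apply: (leD _ _); last first.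
    rewrite size_polyN; apply: leq_trans (size_polyMleq _ _) _.
    rewrite size_polyX addn2 /=; apply: leq_trans p_gt1.
    by rewrite ltnS size_polyC_leq1.
  apply: (leD _ _); first exact: size_expr_affine.
  by rewrite size_polyN; apply: leq_trans (size_polyC_leq1 _) (ltnW p_gt1).
by rewrite leqNgt lt_pQ.
Qed.
End Power.

(** * Powers of x ⊗ a + 1 ⊗ x by left degree *)

Section LeftCoefficients.

(** The coefficient to the right of [x ^+ i] when the [m]-th power of
    x ⊗ a + 1 ⊗ x is expanded along its left factor, see [left_coefP].  Only
    powers of [x] occur on the left, hence nothing has to be commuted. *)
Fixpoint left_coef (R : pzRingType) (a x : R) (m i : nat) : R :=
  if m is m'.+1 then
    (if i is i'.+1 then a * left_coef a x m' i' else 0) + x * left_coef a x m' i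
  else (i == 0)%:R.

Lemma left_coef_gt (R : pzRingType) (a x : R) m i :
  (m < i)%N -> left_coef a x m i = 0.
Proof.
elim: m i => [|m IHm] [|i] //= lt_mi.
by rewrite !IHm ?mulr0 ?addr0 // ltnW.
Qed.

Lemma left_coef_diag (R : pzRingType) (a x : R) m : left_coef a x m m = a ^+ m.
Proof.
elim: m => [|m IHm] //=.
by rewrite IHm left_coef_gt // mulr0 addr0 exprS.
Qed.

Lemma left_coefP (k : fieldType) (A : falgType k) (a x : A) n m : (m < n)%N ->
  (pure x a + pure 1 x) ^+ m = \sum_(i < n) pure (x ^+ i) (left_coef a x m i).
Proof.
elim: m => [|m IHm] lt_mn.
  case: n lt_mn => // n _; rewrite big_ord_recl /= !expr0 big1 ?addr0 // => i _.
  exact: pure0r.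
rewrite exprS IHm; last exact: ltnW.
under [RHS]eq_bigr do rewrite /= pureDr.
rewrite mulrDl !mulr_sumr big_split /=; congr (_ + _); last first.
  by apply: eq_bigr => i _; rewrite mul_pure mul1r.
case: n lt_mn {IHm} => // n lt_mn; rewrite big_ord_recr big_ord_recl /=.
rewrite left_coef_gt // !pure0r mulr0 addr0 add0r.
by apply: eq_bigr => i _; rewrite mul_pure -exprS /bump.
Qed.

End LeftCoefficients.

(** * Algebras of third type *)

Section Presented.
Variables (k : fieldType) (p : nat) (E : thirdTypeData k p) (H : hopfAlg k).
Variables (iota : E -> H) (x : H).
Hypothesis hp : p \in [pchar k].
Hypothesis P : presents iota x.
Notation a := (E3_a E).
Notation c := (@E3_c k p E).

Lemma p_gt1 : (1 < p)%N.
Proof. exact: prime_gt1 (pcharf_prime hp). Qed.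

Let i0 : 'I_p := Ordinal (ltnW p_gt1).
Let i1 : 'I_p := Ordinal p_gt1.

Lemma dim_presents : \dim {:H} = (#|E| * p)%N.
Proof.
pose b (gi : E * 'I_p) := iota gi.1 * x ^+ gi.2.
have := size_basis (X := codom_tuple b) (gx_basis P).
by rewrite card_prod card_ord.
Qed.

Lemma iota_inj : injective iota.
Proof.
have [xi [xib _]] := dual_basis (gx_basis P) => g h eq_gh.
have := xib (g, i0) (h, i0); rewrite /= expr0 mulr1 -eq_gh.
have := xib (g, i0) (g, i0); rewrite /= expr0 mulr1 => ->.
rewrite eqxx xpair_eqE eqxx andbT; case: eqP => // _ /eqP.
by rewrite oner_eq0.
Qed.

Lemma iotaV g : iota g * iota g^-1%g = 1.
Proof. by rewrite -(iotaM P) mulgV (iota1 P). Qed.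

Lemma iotaVg g : iota g^-1%g * iota g = 1.
Proof. by rewrite -(iotaM P) mulVg (iota1 P). Qed.

Lemma iotaX g n : iota (g ^+ n)%g = iota g ^+ n.
Proof.
by elim: n => [|n IHn]; rewrite ?(iota1 P) // expgS exprS (iotaM P) IHn.
Qed.

Lemma central_a g : (g * a = a * g)%g.
Proof. by have /centerP[_ ->] := E3_a_central E. Qed.

Lemma a_neq1 : a != 1%g.
Proof.
have := E3_a_order E; rewrite -order_eq1 => p_dv.
by apply: contraTneq p_dv => ->; rewrite dvdn1 neq_ltn p_gt1 orbT.
Qed.

Lemma iota_a_neq1 : iota a - 1 != 0.
Proof. by rewrite subr_eq0 -(iota1 P) (inj_eq iota_inj) a_neq1. Qed.

Lemma x_iota g :
  x * iota g = iota g * x + c g^-1%g *: (iota (g * a)%g - iota g).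
Proof.
have := x_conj P g^-1%g; rewrite invgK => /(congr1 (fun h => iota g * h)).
rewrite !mulrA iotaV mul1r mulrDr -scalerAr mulrBr mulr1 (iotaM P).
by [].
Qed.

Lemma comul_iota g : comul H (iota g) = pure (iota g) (iota g).
Proof. by have := comul_gx P g i0; rewrite /= !expr0 !mulr1. Qed.

Lemma comul_x : comul H x = pure x (iota a) + pure 1 x.
Proof.
have := comul_gx P 1%g i1; rewrite /= !expr1 (iota1 P) mul1r => ->.
exact: mul1r.
Qed.

Lemma counit_iota g : counit H (iota g) = 1.
Proof. by have := counit_gx P g i0; rewrite /= !expr0 !mulr1. Qed.

Lemma counit_x : counit H x = 0.
Proof. by have := counit_gx P 1%g i1; rewrite /= expr1 (iota1 P) mul1r. Qed.

Lemma presents_ext (A : lalgType k) (f g : {lrmorphism H -> A}) :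
  (forall h, f (iota h) = g (iota h)) -> f x = g x -> f =1 g.
Proof.
move=> fgi fgx; apply: (linear_ext_basis (gx_basis P)) => [||[h i]] /=.
- exact: linearP.
- exact: linearP.
by rewrite !rmorphM !rmorphXn /= fgi fgx.
Qed.

(** Only the values on the basis are prescribed; the relations make the linear
    map so defined compatible with left multiplication by [iota g] and by [x],
    hence with products.  The case [i = p] in [phigx] is where the relation on
    the [p]-th power enters. *)
Lemma presents_lift (A : falgType k) (j : E -> A) (y : A) :
    j 1%g = 1 -> (forall g h, j (g * h)%g = j g * j h) ->
    (forall g, j g * y * j g^-1%g = y + c g *: (j a - 1)) ->
    y ^+ p = y + E3_alpha E *: (j (a ^+ p)%g - 1) ->
  exists phi : {lrmorphism H -> A}, (forall g, phi (iota g) = j g) /\ phi x = y.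
Proof.
move=> j1 jM yconj ypow.
have [phi phib] := linear_from_basis (fun gi : E * 'I_p => j gi.1 * y ^+ gi.2)
  (gx_basis P).
have phig g : phi (iota g) = j g.
  by have := phib (g, i0); rewrite /= !expr0 !mulr1.
have phigx g i : (i <= p)%N -> phi (iota g * x ^+ i) = j g * y ^+ i.
  rewrite leq_eqVlt => /orP[/eqP->|lt_ip]; last exact: (phib (g, Ordinal lt_ip)).
  rewrite (x_pow P) ypow !mulrDr -!scalerAr linearD linearZ /= !mulrBr !mulr1.
  rewrite linearB /= -(iotaM P) !phig -jM; congr (_ + _).
  by have := phib (g, i1); rewrite /= !expr1.
have y_j g : y * j g = j g * y + c g^-1%g *: (j (g * a)%g - j g).
  have := yconj g^-1%g; rewrite invgK => /(congr1 (fun h => j g * h)).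
  by rewrite !mulrA -jM mulgV j1 mul1r mulrDr -scalerAr mulrBr mulr1 jM.
have phigM g m : phi (iota g * m) = j g * phi m.
  move: m; apply: (linear_ext_basis (gx_basis P)) => [d u v|d u v|[h i]] /=.
  - by rewrite mulrDr -scalerAr linearP.
  - by rewrite linearP mulrDr -scalerAr.
  by rewrite mulrA -(iotaM P) !phigx ?(ltnW (ltn_ord i)) // jM mulrA.
have phixM m : phi (x * m) = y * phi m.
  move: m; apply: (linear_ext_basis (gx_basis P)) => [d u v|d u v|[g i]] /=.
  - by rewrite mulrDr -scalerAr linearP.
  - by rewrite linearP mulrDr -scalerAr.
  rewrite mulrA x_iota mulrDl -mulrA -exprS -scalerAl mulrBl.
  rewrite linearD linearZ linearB /= !phigx ?(ltnW (ltn_ord i)) //.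
  by rewrite mulrA y_j mulrDl -scalerAl mulrBl exprS mulrA.
have phiM : {morph phi : u v / u * v}.
  move=> u v; move: u.
  apply: (linear_ext_basis (gx_basis P)) => [d u w|d u w|[g i]] /=.
  - by rewrite mulrDl -scalerAl linearP.
  - by rewrite linearP mulrDl -scalerAl.
  rewrite -mulrA !phigM -mulrA; congr (_ * _).
  have phixX n w : phi (x ^+ n * w) = y ^+ n * phi w.
    by elim: n => [|n IHn]; rewrite ?mul1r // !exprS -!mulrA phixM IHn.
  rewrite phixX; congr (_ * _).
  by have := phixX i 1; rewrite mulr1 -(iota1 P) phig j1 mulr1.
have phi1 : phi 1 = 1 by rewrite -(iota1 P) phig.
pose F : {lrmorphism H -> A} := HB.pack (phi : H -> A) (GRing.Linear.on phi)
  (GRing.isMonoidMorphism.Build H A phi (conj phi1 phiM)).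
exists F; split=> [g|]; first exact: phig.
by have := phigx 1%g 1%N (ltnW p_gt1); rewrite (iota1 P) j1 !mul1r !expr1.
Qed.

(** * Coproducts through their left factor *)

Local Notation bc := (left_coef (iota a) x).

Lemma left_coef_comul (h : H) (xi : E * 'I_p -> {linear H -> k^o})
    (g : E) (i : 'I_p) :
  (forall gi hj : E * 'I_p, xi gi (iota hj.1 * x ^+ hj.2) = (gi == hj)%:R) ->
  tlift (fun u v => (xi (g, i) u : k) *: v) (comul H h) =
  \sum_(m < p) xi (g, m) h *: (iota g * bc m i).
Proof.
move=> xib; move: h.
have bil gi : is_bilinear (fun u v : H => (xi gi u : k) *: v).
  split=> [v d u w|u d v w]; first by rewrite linearP scalerDl scalerA.
  by rewrite scalerDr !scalerA mulrC.
apply: (linear_ext_basis (gx_basis P)) => [d u v|d u v|[h m]] /=.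
- by rewrite !linearP.
- rewrite scaler_sumr -big_split; apply: eq_bigr => j _ /=.
  by rewrite linearP scalerDl scalerA.
rewrite (comul_gx P) (left_coefP _ _ (ltn_ord m)) mulr_sumr linear_sum.
rewrite (bigD1 i) //= big1 ?addr0 => [|j neq_ji]; last first.
  rewrite mul_pure tlift_pure // (xib _ (h, j)) xpair_eqE.
  by rewrite [i == j]eq_sym (negPf neq_ji) andbF scale0r.
rewrite mul_pure tlift_pure // (xib _ (h, i)) xpair_eqE eqxx andbT.
rewrite (bigD1 m) //= big1 ?addr0 => [|j neq_jm]; last first.
  by rewrite (xib _ (h, m)) xpair_eqE (negPf neq_jm) andbF scale0r.
rewrite (xib _ (h, m)) xpair_eqE eqxx andbT.
by case: eqP => [->|_]; rewrite ?scale0r.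
Qed.

Lemma iota_gX g n : iota (g * a ^+ n)%g = iota g * iota a ^+ n.
Proof. by rewrite (iotaM P) iotaX. Qed.

Lemma x_aX n :
  x * iota a ^+ n = iota a ^+ n * x - n%:R *: (iota a ^+ n * (iota a - 1)).
Proof.
have c_aV : c (a ^+ n)^-1%g = - n%:R.
  have c1 : c 1%g = 0.
    have := E3_c_morph (1%g : E) 1%g; rewrite mulg1 => /eqP.
    by rewrite -subr_eq0 opprD addrA subrr sub0r oppr_eq0 => /eqP.
  have cX m : c (a ^+ m)%g = m%:R.
    elim: m => [|m IHm]; first by rewrite expg0 c1.
    by rewrite expgS E3_c_morph E3_c_a IHm -natr1 addrC.
  by apply/eqP; rewrite -addr_eq0 addrC -cX -E3_c_morph mulgV c1.
by rewrite -iotaX x_iota c_aV scaleNr mulrBr mulr1 -(iotaM P).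
Qed.

(** The first coefficient below the diagonal is not a multiple of an element of
    G: it has the term [n.+1%:R *: (iota a ^+ n * x)], which is what
    excludes skew-primitive elements of degree between 2 and p - 1. *)
Lemma left_coef_subdiag n :
  exists d : k,
    bc n.+1 n = n.+1%:R *: (iota a ^+ n * x) + d *: (iota a ^+ n * (iota a - 1)).
Proof.
elim: n => [|n [d IHn]].
  by exists 0; rewrite /= !expr0 mulr1 !mul1r !scale1r scale0r add0r addr0.
exists (d - n.+1%:R); rewrite [bc _ _]/= -/(bc n.+1 n) IHn -/(bc n.+1 n.+1).
rewrite left_coef_diag x_aX mulrDr -!scalerAr !mulrA -exprS.
rewrite addrACA -[X in _ + X]scalerBl; congr (_ + _).
by rewrite -[n.+2%:R]natr1 scalerDl scale1r.
Qed.

(** * Group-like and skew-primitive elements *)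

Section GroupLikes.
Variable xi : E * 'I_p -> {linear H -> k^o}.
Hypothesis xib : forall gi hj : E * 'I_p,
  xi gi (iota hj.1 * x ^+ hj.2) = (gi == hj)%:R.
Hypothesis xiE : forall h, h = \sum_gi (xi gi h : k) *: (iota gi.1 * x ^+ gi.2).

Lemma top_degree (Q : pred (E * 'I_p)) gi : Q gi ->
  exists2 hj, Q hj & forall g (m : 'I_p), (hj.2 < m)%N -> ~~ Q (g, m).
Proof.
move=> Qgi.
case: (arg_maxnP (fun hj : E * 'I_p => hj.2 : nat) Qgi) => hj Qhj maxh.
exists hj => // g m lt_jm; apply: contraL lt_jm => /maxh /=.
by rewrite -leqNgt.
Qed.

Lemma left_coef_top h g (n : 'I_p) :
  (forall m : 'I_p, (n < m)%N -> xi (g, m) h = 0) ->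
  \sum_(m < p) (xi (g, m) h : k) *: (iota g * bc m n) =
    (xi (g, n) h : k) *: iota (g * a ^+ n)%g.
Proof.
move=> top.
rewrite (bigD1 n) //= big1 ?addr0 ?left_coef_diag ?iota_gX // => m neq_mn.
case: (ltngtP m n) => [lt_mn|/top->|eq_mn].
- by rewrite left_coef_gt ?mulr0 ?scaler0.
- by rewrite scale0r.
- by case/eqP: neq_mn; apply: val_inj.
Qed.

(** If (g, n) is a nonzero coordinate c of [h] with [n] maximal, then the left
    factor g x^n of the coproduct is paired with c g a^n, and with c h. *)
Lemma group_like_xi h : h != 0 -> comul H h = pure h h -> exists g, h = iota g.
Proof.
move=> h_neq0 hh.
have /existsP[gi hgi] : [exists gi, xi gi h != 0].
  rewrite -negb_forall; apply: contra h_neq0 => /forallP xi0.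
  by rewrite (xiE h) big1 // => gi _; rewrite (eqP (xi0 gi)) scale0r.
have [[g n] /= hgn top] := top_degree (Q := fun gi => xi gi h != 0) hgi.
exists (g * a ^+ n)%g; have := left_coef_comul h g n xib.
rewrite hh tlift_pure; last first.
  split=> [v d u w|u d v w]; first by rewrite linearP scalerDl scalerA.
  by rewrite scalerDr !scalerA mulrC.
rewrite left_coef_top => [|m /(top g)]; last by rewrite negbK => /eqP.
by apply: scalerI.
Qed.

Lemma xi_iota g h (i : 'I_p) : xi (g, i) (iota h) = ((g, i) == (h, i0))%:R.
Proof. by have := xib (g, i) (h, i0); rewrite /= expr0 mulr1. Qed.

Lemma skew_coef h b g (i : 'I_p) : comul H h = pure h (iota b) + pure 1 h ->
  \sum_(m < p) (xi (g, m) h : k) *: (iota g * bc m i) =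
    (xi (g, i) h : k) *: iota b + ((g, i) == (1%g, i0))%:R *: h.
Proof.
move=> hh; rewrite -(left_coef_comul h g i xib) hh linearD /= -xi_iota (iota1 P).
by rewrite !tlift_pure //; split=> [v d u w|u d v w];
  rewrite ?linearP ?scalerDl ?scalerA // scalerDr !scalerA mulrC.
Qed.

(** Pairing with g x^n gives [b = g a^n].  Pairing with g x^(n-1), when this is
    not the element 1, puts [xi (g, n) h *: (iota g * bc n n.-1)] in the span of G,
    although its coordinate at g a^(n-1) x is [n%:R * xi (g, n) h],
    which is nonzero as 0 < n < p. *)
Lemma skew_top h b g (n : 'I_p) : comul H h = pure h (iota b) + pure 1 h ->
  xi (g, n) h != 0 -> (0 < n)%N ->
  (forall m : 'I_p, (n < m)%N -> xi (g, m) h = 0) ->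
  [/\ g = 1%g, n = i1 & b = a].
Proof.
move=> hh hgn n_gt0 top.
have b_gan : b = (g * a ^+ n)%g.
  have := skew_coef g n hh; rewrite left_coef_top // xpair_eqE.
  rewrite [n == i0]gtn_eqF // andbF scale0r addr0.
  by move/(scalerI hgn)/iota_inj.
have lt_n1 : (n.-1 < p)%N := leq_ltn_trans (leq_pred n) (ltn_ord n).
pose n1 := Ordinal lt_n1.
have [/eqP|neq] := boolP ((g, n1) == (1%g, i0)).
  case=> g1 n10; have n1E : n = i1.
    by apply: val_inj; rewrite /= -(prednK n_gt0) n10.
  by split=> //; rewrite b_gan g1 n1E mul1g expg1.
have := skew_coef g n1 hh; rewrite (negPf neq) scale0r addr0.
have neq_n1 : n1 != n by rewrite neq_ltn /= prednK // leqnn.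
rewrite (bigD1 n) //= (bigD1 n1) //= big1 ?addr0 => [|m /andP[neq_mn neq_mn1]];
  last first.
  case: (ltngtP m n) => [lt_mn|/top->|eq_mn].
  - rewrite left_coef_gt ?mulr0 ?scaler0 // ltn_neqAle -ltnS prednK // lt_mn.
    by rewrite andbT.
  - by rewrite scale0r.
  - by case/eqP: neq_mn; apply: val_inj.
rewrite left_coef_diag -iota_gX.
have [d] := left_coef_subdiag n.-1; rewrite prednK // => ->.
move/(congr1 (xi ((g * a ^+ n.-1)%g, i1))).
rewrite mulrDr -!scalerAr !mulrA -iota_gX mulrBr mulr1 -(iotaM P).
rewrite !(linearD, linearZ, linearN) /= !xi_iota !xpair_eqE !andbF.
have := xib ((g * a ^+ n.-1)%g, i1) ((g * a ^+ n.-1)%g, i1).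
rewrite /= expr1 eqxx => ->; rewrite subrr !scaler0 !addr0 => /eqP.
rewrite !scaler_eq0 oner_eq0 orbF (negPf hgn) /= -(dvdn_pcharf hp) gtnNdvd //.
Qed.

(** Let c be the coordinate of [h] at g, where g is not 1.  Pairing with g gives
    c g = c b, so c = 0 unless g = b. *)
Lemma skew_degree0 h b : comul H h = pure h (iota b) + pure 1 h ->
  (forall g (n : 'I_p), (0 < n)%N -> xi (g, n) h = 0) ->
  exists l0 l1 : k, h = l0 *: 1 + l1 *: iota b.
Proof.
move=> hh h0.
have supp g : g != 1%g -> g != b -> xi (g, i0) h = 0.
  move=> g1 gb; have := skew_coef g i0 hh.
  rewrite left_coef_top => [|m /h0->] //; rewrite expg0 mulg1.
  rewrite xpair_eqE (negPf g1) scale0r addr0 => /eqP.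
  rewrite -subr_eq0 -scalerBr scaler_eq0 subr_eq0 (inj_eq iota_inj) (negPf gb).
  by rewrite orbF => /eqP.
exists (xi (1%g, i0) h), (if b == 1%g then 0 else (xi (b, i0) h)).
rewrite {1}(xiE h) (bigD1 (1%g, i0)) //= expr0 mulr1 (iota1 P); congr (_ + _).
case: eqP => [b1|/eqP b1].
  rewrite scale0r big1 // => -[g n] /= neq; have [n_gt0|] := ltnP 0 n.
    by rewrite h0 // scale0r.
  rewrite leqn0 => /eqP n0; have nE : n = i0 by apply: val_inj.
  rewrite nE xpair_eqE eqxx andbT in neq *.
  by rewrite supp ?scale0r // b1.
rewrite (bigD1 (b, i0)) /=; last by rewrite xpair_eqE (negPf b1).
rewrite expr0 mulr1 big1 ?addr0 // => -[g n] /= /andP[neq1 neqb].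
have [n_gt0|] := ltnP 0 n; first by rewrite h0 // scale0r.
rewrite leqn0 => /eqP n0; have nE : n = i0 by apply: val_inj.
rewrite nE !xpair_eqE !eqxx !andbT in neq1 neqb *.
by rewrite supp ?scale0r.
Qed.

(** By [skew_top] the coordinates of positive degree of [h] reduce to that of
    [x], and subtracting the multiple of [x] leaves a skew-primitive element in
    the span of G. *)
Lemma skew_primitive_xi h b : comul H h = pure h (iota b) + pure 1 h ->
  exists mu l0 l1 : k,
    h = mu *: x + (l0 *: 1 + l1 *: iota b) /\ (mu != 0 -> b = a).
Proof.
move=> hh; pose Q gi := (xi gi h != 0) && (0 < gi.2)%N.
have deg1 gi : Q gi -> gi = (1%g, i1) /\ b = a.
  move=> Qgi; have [[g n] /andP[/= hgn n_gt0] top] := top_degree Qgi.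
  have topn g' (m : 'I_p) : (n < m)%N -> xi (g', m) h = 0.
    move=> lt_nm; have := top g' m lt_nm.
    by rewrite /Q /= (leq_trans _ lt_nm) // andbT negbK => /eqP.
  have [_ n1 ba] := skew_top hh hgn n_gt0 (topn g).
  case: gi Qgi => g' m /andP[/= hgm m_gt0].
  have mE : m = i1.
    apply: val_inj; apply/eqP; rewrite /= eqn_leq m_gt0 andbT leqNgt.
    by apply: contra hgm => lt1m; rewrite (topn g') // n1.
  rewrite mE -n1 in hgm *.
  by have [-> -> ->] := skew_top hh hgm n_gt0 (topn g').
pose mu : k := xi (1%g, i1) h.
have mu_ba : mu != 0 -> b = a 
  by move=> mu0; case: (deg1 (1%g, i1)) => //; rewrite /Q /= andbT.
have xi_x gi : xi gi x = (gi == (1%g, i1))%:R.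
  by have := xib gi (1%g, i1); rewrite /= (iota1 P) mul1r expr1.
have [||l0 [l1 hE]] := @skew_degree0 (h - mu *: x) b.
- rewrite linearB linearZ /= hh comul_x pureDl pureDr pureNl pureNr.
  rewrite pureZl pureZr scalerDr opprD addrACA.
  have [->|/mu_ba->] := eqVneq mu 0; last by [].
  by rewrite !scale0r.
- move=> g n n_gt0; rewrite linearB linearZ /= xi_x.
  have [eq1|neq1] := eqVneq (g, n) (1%g, i1).
    by rewrite eq1 -[mu *: _]/(mu * 1) mulr1 subrr.
  rewrite scaler0 subr0; apply/eqP; apply: contraNT neq1 => hgn.
  by case: (deg1 (g, n)) => [|->] //; rewrite /Q /= hgn.
by exists mu, l0, l1; rewrite -hE addrC subrK.
Qed.

End GroupLikes.

Lemma group_like h : h != 0 -> comul H h = pure h h -> exists g, h = iota g.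
Proof.
have [xi [xib xiE]] := dual_basis (gx_basis P).
exact: group_like_xi xib xiE h.
Qed.

Lemma skew_primitive h b : comul H h = pure h (iota b) + pure 1 h ->
  exists mu l0 l1 : k,
    h = mu *: x + (l0 *: 1 + l1 *: iota b) /\ (mu != 0 -> b = a).
Proof.
have [xi [xib xiE]] := dual_basis (gx_basis P).
exact: skew_primitive_xi xib xiE h b.
Qed.

(** Conjugation by [iota a ^+ n] turns [x] into [x + n%:R *: (iota a - 1)] and
    fixes [x ^+ p - x], which is the hypothesis of [expr_affine]. *)
Lemma shift_pow (l : k) :
  (x + l *: (iota a - 1)) ^+ p =
    x ^+ p + l *: (iota a - 1) + (l ^+ p - l) *: (iota (a ^+ p)%g - 1).
Proof.
have iota_ap : (iota a - 1) ^+ p = iota (a ^+ p)%g - 1.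
  have hpH : p \in [pchar H] by rewrite pchar_lalg.
  rewrite -(pFrobenius_autE hpH) pFrobenius_autB_comm; last exact: commr1.
  by rewrite pFrobenius_aut1 pFrobenius_autE iotaX.
rewrite -iota_ap; apply: (expr_affine hp) => n.
have aV : iota a ^+ n * iota (a ^+ n)^-1%g = 1 by rewrite -iotaX iotaV.
have conjX w m : (iota a ^+ n * w * iota (a ^+ n)^-1%g) ^+ m =
    iota a ^+ n * w ^+ m * iota (a ^+ n)^-1%g.
  elim: m => [|m IHm]; first by rewrite !expr0 mulr1 aV.
  rewrite exprS IHm exprS !mulrA; congr (_ * _ * _).
  by rewrite -mulrA -iotaX iotaVg mulr1.
have conjx : iota a ^+ n * x * iota (a ^+ n)^-1%g = x + n%:R *: (iota a - 1).
  have -> : iota a ^+ n * x =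
      x * iota a ^+ n + n%:R *: ((iota a - 1) * iota a ^+ n).
    rewrite x_aX mulrBr mulr1 mulrBl mul1r -exprS -exprSr.
    by rewrite subrK.
  by rewrite mulrDl -scalerAl -!mulrA aV !mulr1.
rewrite -conjx conjX (x_pow P) mulrDr mulrDl conjx -!addrA; congr (_ + _).
rewrite addrC; congr (_ + _).
rewrite -scalerAr -scalerAl iotaX; congr (_ *: _).
by rewrite mulrBr mulrBl mulr1 aV -exprD addnC exprD -mulrA aV mulr1.
Qed.
End Presented.

(** * The two implications *)

Lemma hopf_iso_group_iso (k : fieldType) (p : nat) (hp : p \in [pchar k])
    (E E' : thirdTypeData k p) (H H' : hopfAlg k)
    (iota : E -> H) (x : H) (iota' : E' -> H') (x' : H') :
  presents iota x -> presents iota' x' -> hopf_isomorphic H H' ->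
  exists f : {morphism [set: E] >-> E'},
    [/\ isom [set: E] [set: E'] f,
        f (E3_a E) = E3_a E'
      & forall g, E3_c (f g) = E3_c g].
Proof.
move=> P P' [phi [[phiD _ _] phi_bij]].
have phi_inj := bij_inj phi_bij.
have phi_iota g : exists g', phi (iota g) == iota' g'.
  have [||g' ->] := @group_like _ _ _ _ _ _ P' (phi (iota g)).
  - rewrite -(linear0 phi) (inj_eq phi_inj); apply/eqP => ig0.
    by have /eqP := iotaV P g; rewrite ig0 mul0r eq_sym oner_eq0.
  - by rewrite phiD (comul_iota hp P) tmap_pure.
  - by exists g'.
pose f g := xchoose (phi_iota g).
have fE g : phi (iota g) = iota' (f g) := eqP (xchooseP (phi_iota g)).
have fM : {in [set: E] &, {morph f : g h / (g * h)%g}}.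
  move=> g h _ _; apply: (iota_inj hp P').
  by rewrite -fE (iotaM P) rmorphM /= !fE (iotaM P').
have f_inj : injective f.
  by move=> g h fgh; apply/(iota_inj hp P)/phi_inj; rewrite !fE fgh.
have cardE : #|E| = #|E'|.
  have := bij_linear_dim phi_bij; rewrite (dim_presents P) (dim_presents P').
  by move/eqP; rewrite eqn_pmul2r ?(ltnW (p_gt1 hp)) // => /eqP.
have fa_neq1 : iota' (f (E3_a E)) != 1.
  by rewrite -fE -(rmorph1 phi) (inj_eq phi_inj) -subr_eq0 (iota_a_neq1 hp P).
have conj_phi g : iota' (f g) * phi x * iota' (f g)^-1%g =
    phi x + E3_c g *: (iota' (f (E3_a E)) - 1).
  have fV : iota' (f g)^-1%g = phi (iota g^-1%g).
    rewrite -[LHS]mulr1 -(rmorph1 phi) -(iotaV P g) rmorphM /= mulrA fE.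
    by rewrite (iotaVg P') mul1r.
  by rewrite fV -!fE -!rmorphM (x_conj P) /= linearD linearZ linearB /= rmorph1.
have phix : comul H' (phi x) =
    pure (phi x) (iota' (f (E3_a E))) + pure 1 (phi x).
  by rewrite phiD (comul_x hp P) linearD /= !tmap_pure rmorph1 /= fE.
have [mu [l0 [l1 [phixE mu_fa]]]] := skew_primitive hp P' phix.
have fa : f (E3_a E) = E3_a E'.
  apply: mu_fa; apply: contra fa_neq1 => /eqP mu0.
  (* For mu = 0 the element phi x lies in the span of 1 and f a, so commutes *)
  (* with f a.                                                               *)
  have := conj_phi (E3_a E); rewrite phixE mu0 scale0r add0r E3_c_a scale1r.
  rewrite mulrDr mulrDl -!scalerAr -!scalerAl mulr1 (iotaV P') -mulrA.
  rewrite (iotaV P') mulr1 => /esym/(canRL (addKr _)); rewrite addNr => /eqP.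
  by rewrite subr_eq0.
have muc g : mu * E3_c (f g) = E3_c g.
  have := conj_phi g; rewrite phixE fa.
  have centr :
      iota' (f g) * (l0 *: 1 + l1 *: iota' (E3_a E')) * iota' (f g)^-1%g =
      l0 *: 1 + l1 *: iota' (E3_a E').
    rewrite mulrDr mulrDl -!scalerAr -!scalerAl mulr1 (iotaV P').
    by rewrite -(iotaM P') central_a (iotaM P') -mulrA (iotaV P') mulr1.
  rewrite mulrDr mulrDl centr -scalerAr -scalerAl (x_conj P') scalerDr scalerA.
  rewrite [LHS]addrAC => /addrI/eqP.
  rewrite -subr_eq0 -scalerBl scaler_eq0 (negPf (iota_a_neq1 hp P')) orbF.
  by rewrite subr_eq0 => /eqP.
have mu1 : mu = 1 by have := muc (E3_a E); rewrite fa !E3_c_a mulr1.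
exists (Morphism fM); split=> [|//|g /=]; last by rewrite -[LHS]mul1r -mu1 muc.
apply/isomP; split.
  by apply/injmP => g h _ _ /f_inj.
apply/eqP; rewrite eqEcard subsetT /= card_injm //.
  by rewrite !cardsT cardE.
by apply/injmP => g h _ _ /f_inj.
Qed.

Lemma artin_schreier (k : closedFieldType) (p : nat) (d : k) :
  (1 < p)%N -> exists l : k, l ^+ p - l = d.
Proof.
move=> p_gt1; have [|l] := @closed_rootP k ('X^p - ('X + d%:P)) _.
  have sz : size ('X^p - ('X + d%:P) : {poly k}) = p.+1.
    rewrite size_polyDl size_polyXn // size_polyN.
    apply: leq_ltn_trans (size_polyD _ _) _; rewrite gtn_max size_polyX.
    by rewrite !ltnS p_gt1 (leq_trans (size_polyC_leq1 _)) // ltnW.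
  by rewrite sz eqSS -lt0n ltnW.
rewrite rootE !(hornerD, hornerN, hornerXn, hornerX, hornerC) subr_eq0.
by move/eqP=> lp; exists l; rewrite lp addrAC subrr add0r.
Qed.

Lemma group_iso_hopf_iso (k : closedFieldType) (p : nat) (hp : p \in [pchar k])
    (E E' : thirdTypeData k p) (H H' : hopfAlg k)
    (iota : E -> H) (x : H) (iota' : E' -> H') (x' : H')
    (f : {morphism [set: E] >-> E'}) :
  presents iota x -> presents iota' x' ->
  isom [set: E] [set: E'] f -> f (E3_a E) = E3_a E' ->
  (forall g, E3_c (f g) = E3_c g) -> hopf_isomorphic H H'.
Proof.
move=> P P' /isomP[/injmP f_inj f_im] fa fc.
have fM g h : f (g * h)%g = (f g * f h)%g by rewrite morphM ?inE.
have fV g : f g^-1%g = (f g)^-1%g by rewrite morphV ?inE.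
have [l lE] := artin_schreier (E3_alpha E - E3_alpha E') (p_gt1 hp).
pose y := x' + l *: (iota' (E3_a E') - 1).
have [|g h|g||phi [phi_iota phi_x]] :=
  @presents_lift _ _ _ _ _ _ hp P H' (iota' \o f) y.
- by rewrite /= morph1 (iota1 P').
- by rewrite /= fM (iotaM P').
- rewrite /= fV fa -fc mulrDr mulrDl (x_conj P') addrAC; congr (_ + _ + _).
  rewrite -scalerAr -scalerAl mulrBr mulrBl mulr1 (iotaV P') -(iotaM P').
  by rewrite central_a (iotaM P') -mulrA (iotaV P') mulr1.
- rewrite /= morphX ?inE // fa (shift_pow hp P') (x_pow P') lE scalerBl.
  rewrite [x' + _ + _]addrAC -/y -addrA; congr (_ + _).
  by rewrite addrCA subrr addr0.
have phiD h : comul H' (phi h) = tmap phi phi (comul H h).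
  move: h; apply: (@presents_ext _ _ _ _ _ _ P _ (comul H' \o phi)
    (tmap phi phi \o comul H)) => [g|] /=.
    by rewrite phi_iota (comul_iota hp P') (comul_iota hp P) tmap_pure /= phi_iota.
  rewrite phi_x (comul_x hp P) [RHS]linearD /= !tmap_pure rmorph1 /=.
  rewrite phi_x phi_iota /= fa.
  rewrite /y linearD linearZ linearB /= (comul_x hp P') (comul_iota hp P') rmorph1.
  rewrite !(pureDl, pureDr, pureZl, pureZr, pureNl, pureNr).
  by rewrite [RHS]addrACA -scalerDr addrA subrK.
have phie h : counit H' (phi h) = counit H h.
  move: h; apply: (@presents_ext _ _ _ _ _ _ P _ (counit H' \o phi)
    (counit H)) => [g|] /=.
    by rewrite phi_iota (counit_iota hp P') (counit_iota hp P).
  rewrite phi_x linearD linearZ linearB /= (counit_x hp P') (counit_x hp P).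
  by rewrite (counit_iota hp P') rmorph1 subrr scaler0 addr0.
exists phi; split; first by split=> //; apply: bialgebra_morphism_antipode.
have cardE : #|E| = #|E'|.
  by rewrite -!cardsT -f_im card_injm //; apply/injmP.
apply: surj_linear_bij.
  by rewrite (dim_presents P) (dim_presents P') cardE.
have [xi' [_ xiE']] := dual_basis (gx_basis P').
have fsurj g' : exists g, f g = g'.
  have : g' \in (f @* [set: E])%g by rewrite f_im inE.
  by case/morphimP=> g _ _ ->; exists g.
have basis_im (gi : E' * 'I_p) : exists v, phi v == iota' gi.1 * x' ^+ gi.2.
  have [g fg] := fsurj gi.1.
  exists (iota g * (x - l *: (iota (E3_a E) - 1)) ^+ gi.2).
  rewrite rmorphM rmorphXn /= linearB linearZ linearB /= rmorph1 !phi_iota phi_x.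
  by rewrite /= fa fg /y addrK.
move=> w; exists (\sum_gi (xi' gi w : k) *: xchoose (basis_im gi)).
rewrite linear_sum [RHS]xiE'; apply: eq_bigr => gi _.
by rewrite linearZ /= (eqP (xchooseP (basis_im gi))).
Qed.

Theorem lemma4p17 (k : closedFieldType) (p : nat) (hp : p \in [pchar k])
    (E E' : thirdTypeData k p) (H H' : hopfAlg k)
    (hH : is_third_type E H) (hH' : is_third_type E' H') :
  hopf_isomorphic H H' <->
  exists f : {morphism [set: E] >-> E'},
    [/\ isom [set: E] [set: E'] f,
        f (E3_a E) = E3_a E'
      & forall g, E3_c (f g) = E3_c g].
Proof.
case: hH hH' => [iota [x P]] [iota' [x' P']]; split.
  exact: hopf_iso_group_iso P P'.
by case=> f [f_isom fa fc]; apply: (group_iso_hopf_iso hp P P' f_isom fa fc).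
Qed.
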